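(* Let $S\subset\{(x,y,z)\in\mathbb{R}^3 : z\neq 0\}$ be a surface with intensity function $J:S\to\mathbb{R}$, let $\iota(x,y,z)=(x/z,\,y/z)$, let $U=\iota(S)\subset\mathbb{R}^2$, and let $I:U\to\mathbb{R}$ be an image of $(S,J)$ (as defined in the context). For $c\in\mathbb{R}$ let $I_c=\partial\{q\in U : I(q)<c\}$. If $p\in U$ satisfies $p\in I_c\cap I_{c'}$ for some real numbers $c\neq c'$, then at least one of the following holds: (1) the intensity $J$ on the surface is not smooth; (2) the surface $S$ is not smooth; (3) the surface $S$ is occluded.
   Context: The optical centre of the camera is the origin of $\mathbb{R}^3$, and image formation is the map $\iota:\{(x,y,z)\in\mathbb{R}^3: z\neq0\}\to\mathbb{R}^2$, $\iota(x,y,z)=(x/z,y/z)$. Surface and image: a surface $S$ is a subset of $\{z\ne 0\}$, a priori not assumed smooth, with a real-valued intensity function $J:S\to\mathbb{R}$, a priori not assumed smooth. An image of $(S,J)$ is a function $I:U\to\mathbb{R}$ on $U=\iota(S)$ such that for every $q\in U$ there is a point $a\in S$ (the point seen at $q$) with $\iota(a)=q$ and $I(q)=J(a)$. Smoothness: $S$ is smooth if it is an embedded two-dimensional $C^\infty$ submanifold (without boundary) of $\mathbb{R}^3$. When $S$ is smooth, $J$ is smooth if it is a $C^\infty$ function on the manifold $S$. Occlusion: a smooth surface $S$ is unoccluded if $\iota|_S$ is injective (no two points of $S$ have the same image) and $S$ has no occluding points, where an occluding point is a point $a\in S$ at which the (affine) tangent plane to $S$ passes through the optical centre (the origin). Otherwise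 $S$ is occluded. Boundary: $\partial$ denotes the topological boundary of a subset of $U$ (closure minus interior, relative to $U$ with the subspace topology from $\mathbb{R}^2$). The conclusion says that it is impossible that $S$ is smooth, $J$ is smooth on $S$, and $S$ is unoccluded all at once. *)

(* Defs.v *)
From HB Require Import structures.
From mathcomp Require Import all_boot all_order all_algebra.
From mathcomp Require Import all_classical all_reals all_analysis.

Set Implicit Arguments.
Unset Strict Implicit.
Unset Printing Implicit Defensive.

Import Order.TTheory GRing.Theory Num.Theory.
Import numFieldNormedType.Exports.

Local Open Scope classical_set_scope.
Local Open Scope ring_scope.

(* Only used for open A and finite-dimensional V, W.  As 'D_v f x is linear in
   v, quantifying over all directions v amounts to quantifying over the partial
   derivatives. *)
Fixpoint Ck_on (R : realType) (V W : normedModType R) (k : nat)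
    (A : set V) (f : V -> W) : Prop :=
  if k is k'.+1 then
    (forall x, A x -> differentiable f x) /\
    (forall v, Ck_on k' A (fun x => 'D_v f x))
  else forall x, A x -> {for x, continuous f}.

Definition smooth_on (R : realType) (V W : normedModType R)
    (A : set V) (f : V -> W) : Prop :=
  forall k, Ck_on k A f.

Definition slice (R : realType) (w : 'rV[R]_2) : 'rV[R]_3 :=
  row_mx w (0 : 'rV[R]_1).

(* phi restricts to a diffeomorphism from V onto W, with inverse psi, taking
   S `&` V to the points of W in the plane of zero third coordinate.  The
   values of phi outside V and of psi outside W are irrelevant. *)
Definition slice_chart (R : realType) (S : set 'rV[R]_3)
    (V W : set 'rV[R]_3) (phi psi : 'rV[R]_3 -> 'rV[R]_3) : Prop :=
  [/\ open V /\ open W,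
      (forall x, V x -> W (phi x) /\ psi (phi x) = x),
      (forall y, W y -> V (psi y) /\ phi (psi y) = y),
      smooth_on V phi /\ smooth_on W psi
    & forall x, V x -> (S x <-> phi x 0 2 = 0)].

Definition smooth_surface (R : realType) (S : set 'rV[R]_3) : Prop :=
  forall a, S a -> exists (V W : set 'rV[R]_3) phi psi, V a /\ slice_chart S V W phi psi.

(* J is a total function, but since psi (slice w) lies in S whenever slice w
   lies in W, only its values on S matter. *)
Definition smooth_intensity (R : realType) (S : set 'rV[R]_3)
    (J : 'rV[R]_3 -> R) : Prop :=
  forall a, S a -> exists (V W : set 'rV[R]_3) phi psi,
    [/\ V a, slice_chart S V W phi psi
      & smooth_on [set w | W (slice w)] (fun w => J (psi (slice w)) : R^o)].

Definition tangent_space (R : realType) (S : set 'rV[R]_3) (a : 'rV[R]_3)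
    : set 'rV[R]_3 :=
  [set v | exists (e : R) (g : R -> 'rV[R]_3),
    [/\ 0 < e,
        smooth_on (V := R^o) [set t | `|t| < e] g,
        (forall t, `|t| < e -> S (g t)),
        g 0 = a
      & derive1 g 0 = v]].

Definition affine_tangent_plane (R : realType) (S : set 'rV[R]_3)
    (a : 'rV[R]_3) : set 'rV[R]_3 :=
  [set a + v | v in tangent_space S a].

(* Meaningful for points whose third coordinate is nonzero. *)
Definition image_formation (R : realType) (a : 'rV[R]_3) : 'rV[R]_2 :=
  \row_(i < 2) [:: a 0 0 / a 0 2; a 0 1 / a 0 2]`_i.

Definition image_domain (R : realType) (S : set 'rV[R]_3) : set 'rV[R]_2 :=
  [set image_formation a | a in S].

Definition occluding_point (R : realType) (S : set 'rV[R]_3)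
    (a : 'rV[R]_3) : Prop :=
  S a /\ affine_tangent_plane S a 0.

Definition unoccluded (R : realType) (S : set 'rV[R]_3) : Prop :=
  (forall a b, S a -> S b -> image_formation a = image_formation b -> a = b) /\
  ~ (exists a, occluding_point S a).

Definition occluded (R : realType) (S : set 'rV[R]_3) : Prop :=
  ~ unoccluded S.

Definition is_image (R : realType) (S : set 'rV[R]_3) (J : 'rV[R]_3 -> R)
    (I : 'rV[R]_2 -> R) : Prop :=
  forall q, image_domain S q ->
    exists a, [/\ S a, image_formation a = q & I q = J a].

(* In the topology of subspace U the points outside U are isolated, so for
   A `<=` U this is the boundary of A relative to U. *)
Definition rel_boundary (T : topologicalType) (U A : set T) : set T :=
  closure (A : set (subspace U)) `\` interior (A : set (subspace U)).

Definition isophote (R : realType) (U : set 'rV[R]_2) (I : 'rV[R]_2 -> R)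
    (c : R) : set 'rV[R]_2 :=
  rel_boundary U [set q | U q /\ I q < c].

(* Main.v *)
(* On a smooth unoccluded surface the image is continuous on [U], and a
   continuous [I] takes the value [c] on the relative boundary of [I < c], so that
   distinct isophotes cannot meet.

   Continuity of [I] reduces to local surjectivity: parametrizing the surface
   near the point seen at [p] by [f], every [q] near [p] must be the image of
   some [f w] with [w] near [w0].  Since [p] is not the image of an occluding
   point, the line of sight is not tangent to the surface, so the derivative of
   [f] at [w0] followed by the projection along that line is invertible.  That
   [f w] lies on the line of sight through [q] is then an equation in [w] that a
   simplified Newton iteration solves: for every [q] near [p] the iteration is a
   contraction near [w0]. *)
Require Import Defs.
From HB Require Import structures.
From mathcomp Require Import all_boot all_order all_algebra.
From mathcomp Require Import all_classical all_reals all_analysis.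
From mathcomp Require Import ring.

Set Implicit Arguments.
Unset Strict Implicit.
Unset Printing Implicit Defensive.

Import Order.TTheory GRing.Theory Num.Theory.
Import numFieldNormedType.Exports.

Local Open Scope classical_set_scope.
Local Open Scope ring_scope.

(* The library has the two structures on matrices but not their join. *)
HB.instance Definition _ (R : realType) m n := Complete.on 'M[R]_(m, n).

(** * Entrywise bounds for the matrix norm *)

Lemma mx_norm_le (R : realDomainType) m n (A : 'M[R]_(m, n)) (e : R) :
  0 <= e -> (forall i j, `|A i j| <= e) -> `|A| <= e.
Proof.
by move=> e0 Ae; rewrite [leLHS]/Num.Def.normr /= mx_normrE bigmax_le// => -[].
Qed.

Lemma entry_le_mx_norm (R : realDomainType) m n (A : 'M[R]_(m, n)) i j :
  `|A i j| <= `|A|.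
Proof.
rewrite [leRHS]/Num.Def.normr /= mx_normrE.
exact: (le_bigmax _ (fun ij => `|A ij.1 ij.2|) (i, j)).
Qed.

(** The norm is the largest absolute value of an entry, hence the factor [n]: each entry of the
    product is a sum of [n] terms. *)
Lemma mx_norm_mulmx (R : realDomainType) m n p
    (A : 'M[R]_(m, n)) (B : 'M[R]_(n, p)) :
  `|A *m B| <= n%:R * (`|A| * `|B|).
Proof.
apply: mx_norm_le => [|i j]; first by rewrite !mulr_ge0.
rewrite mxE (le_trans (ler_norm_sum _ _ _))//.
rewrite mulr_natl -[X in _ *+ X]card_ord -sumr_const ler_sum// => k _.
by rewrite normrM ler_pM// entry_le_mx_norm.
Qed.

(** * Contractions and the simplified Newton iteration *)

(** The closed ball is stable under [T]: by contraction [T x] is within [r / 2] of [T x0], which is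
    within [r / 2] of [x0]. Banach's theorem then applies. *)
Lemma closed_ball_fixpoint (R : realType) (X : completeNormedModType R)
    (T : X -> X) (x0 : X) (r : R) : 0 < r ->
  (forall x y, `|x - x0| <= r -> `|y - x0| <= r ->
    `|T x - T y| <= 2^-1 * `|x - y|) ->
  `|T x0 - x0| <= r / 2 ->
  exists2 x, `|x - x0| <= r & T x = x.
Proof.
move=> r0 lipT Tx0; pose U := closed_ball_ Num.norm x0 r.
have UE x : U x = (`|x - x0| <= r) by rewrite /U /closed_ball_ /= distrC.
have TU : set_fun U U T.
  move=> x; rewrite !UE => Ux.
  rewrite -(subrKA (T x0)) (le_trans (ler_normD _ _))// (splitr r) lerD//.
  rewrite (le_trans (lipT _ _ _ _))// ?subrr ?normr0 ?(ltW r0)//.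
  by rewrite mulrC ler_wpM2r// invr_ge0.
pose F : {fun U >-> U} := HB.pack T (isFun.Build _ _ U U T TU).
have [||| x Ux xE] := @banach_fixed_point R X U F.
- have h0 : 0 <= 2^-1 :> R by rewrite invr_ge0.
  exists (NngNum h0); split => /=.
    by rewrite invf_lt1// ltr1n.
  by move=> [x y] /=; rewrite !UE => -[Ux Uy]; exact: lipT.
- exact: closed_closed_ball_.
- by exists x0; rewrite UE subrr normr0 ltW.
by exists x => //; rewrite -UE.
Qed.

(** The inverse [M] of [B *m P0] stays fixed while [P] varies: [T w = w - f w *m P *m M] contracts
    for every [P] close to [P0], and a fixed point solves the equation because [M] is invertible. *)
Lemma strict_differentiable_solve (R : realType) n m (f : 'rV[R]_n -> 'rV[R]_m)
    (B : 'M[R]_(n, m)) (P0 : 'M[R]_(m, n)) (w0 : 'rV[R]_n) :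
  (forall e, 0 < e -> exists2 d, 0 < d & forall w w', `|w - w0| <= d ->
    `|w' - w0| <= d -> `|f w - f w' - (w - w') *m B| <= e * `|w - w'|) ->
  B *m P0 \in unitmx -> f w0 *m P0 = 0 ->
  forall r, 0 < r ->
    \forall P \near P0, exists2 w, `|w - w0| <= r & f w *m P = 0.
Proof.
move=> fB BP0 fw0 r r0; pose M := invmx (B *m P0).
pose c := m%:R * (n%:R * `|M|).
have c0 : 0 <= c by rewrite !mulr_ge0.
have mulM (x : 'rV[R]_m) (Q : 'M[R]_(m, n)) :
    `|x *m Q *m M| <= c * (`|x| * `|Q|).
  have -> : c * (`|x| * `|Q|) = n%:R * (m%:R * (`|x| * `|Q|) * `|M|).
    by rewrite /c; ring.
  rewrite (le_trans (mx_norm_mulmx _ _))// ler_wpM2l// ler_wpM2r//.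
  exact: mx_norm_mulmx.
(* [e] and [u] each bound one of the two error terms of the Lipschitz estimate by
   a quarter of the distance; [v] bounds the first Newton step by [s / 2]. *)
pose e := (4 * (c + 1) * (`|P0| + 1))^-1.
have c1 : 0 < c + 1 by rewrite ltr_wpDl.
have P1 : 0 < `|P0| + 1 by rewrite ltr_wpDl.
have e0 : 0 < e by rewrite invr_gt0 !mulr_gt0.
have [d d0 fd] := fB _ e0.
(* Staying below [d] makes the estimate [fd] available; staying below [r] places the solution where
   it is wanted. *)
pose s := Num.min r d.
have s0 : 0 < s by rewrite lt_min r0.
pose u := (4 * (c + 1) * (n%:R * `|B| + 1))^-1.
pose v := s / 2 / ((c + 1) * (`|f w0| + 1)).
have B1 : 0 < n%:R * `|B| + 1 by rewrite ltr_wpDl// mulr_ge0.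
have f1 : 0 < `|f w0| + 1 by rewrite ltr_wpDl.
have u0 : 0 < u by rewrite invr_gt0 !mulr_gt0.
have v0 : 0 < v by rewrite !divr_gt0// mulr_gt0.
apply/nbhs_normP; exists (Num.min 1 (Num.min u v)) => [|P /=].
  by rewrite /= !lt_min ltr01 u0.
rewrite distrC !lt_min => /and3P[/ltW PP1 /ltW PPu /ltW PPv].
pose T w := w - f w *m P *m M.
have P0M : B *m P0 *m M = 1%:M by rewrite mulmxV.
have P_le : `|P| <= `|P0| + 1.
  by rewrite -[P in leLHS](subrK P0) addrC (le_trans (ler_normD _ _))// lerD2l.
have lipT w w' : `|w - w0| <= s -> `|w' - w0| <= s ->
    `|T w - T w'| <= 2^-1 * `|w - w'|.
  rewrite !le_min => /andP[_ wd] /andP[_ w'd].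
  have /= := fd _ _ wd w'd; set rem := _ - _ *m B => rem_le.
  (* Since [M] inverts [B *m P0], the identity part of [T] cancels the main linear term; only the
     contributions of [P - P0] and of [rem] are left. *)
  have -> : T w - T w' = - ((w - w') *m B *m (P - P0) *m M + rem *m P *m M).
    have dE : (w - w') *m B *m P0 *m M = w - w'.
      by rewrite -(mulmxA _ B) -(mulmxA _ (B *m P0)) P0M mulmx1.
    rewrite (mulmxBr _ P) /rem (mulmxBl ((w - w') *m B *m P)) dE.
    rewrite (mulmxBl (f w - f w')) (mulmxBl ((f w - f w') *m P)).
    rewrite [in RHS]addrC subrKA [RHS]opprB (mulmxBl (f w)) (mulmxBl (f w *m P)).
    by rewrite /T opprD addrACA -opprD.
  rewrite normrN (le_trans (ler_normD _ _))//.
  have -> : 2^-1 * `|w - w'| = 4^-1 * `|w - w'| + 4^-1 * `|w - w'| by field.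
  apply: lerD; rewrite (le_trans (mulM _ _))//.
    rewrite (@le_trans _ _ (c * (n%:R * (`|w - w'| * `|B|) * u)))//.
      by rewrite ler_wpM2l// ler_pM// mx_norm_mulmx.
    rewrite (_ : _ * _ = (c * (n%:R * `|B|)) * u * `|w - w'|); last by ring.
    rewrite ler_wpM2r// ler_pdivrMr ?mulr_gt0//.
    rewrite (_ : 4^-1 * _ = (c + 1) * (n%:R * `|B| + 1)); last by field.
    by rewrite ler_pM ?mulr_ge0// lerDl.
  rewrite (@le_trans _ _ (c * (e * `|w - w'| * (`|P0| + 1))))//.
    by rewrite ler_wpM2l// ler_pM.
  rewrite (_ : _ * _ = c * (`|P0| + 1) * e * `|w - w'|); last by ring.
  rewrite ler_wpM2r// ler_pdivrMr ?mulr_gt0//.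
  rewrite (_ : 4^-1 * _ = (c + 1) * (`|P0| + 1)); last by field.
  by rewrite ler_wpM2r ?(ltW P1)// lerDl.
have [|w] := closed_ball_fixpoint s0 lipT.
  (* As [f w0 *m P0 = 0], the first step sees only [P - P0]. *)
  have -> : T w0 - w0 = - (f w0 *m (P - P0) *m M).
    by rewrite /T addrAC subrr add0r mulmxBr fw0 subr0.
  rewrite normrN (le_trans (mulM _ _))// (@le_trans _ _ (c * (`|f w0| * v)))//.
    by rewrite ler_wpM2l// ler_wpM2l.
  have -> : c * (`|f w0| * v) =
      c * `|f w0| * (s / 2) / ((c + 1) * (`|f w0| + 1)) by rewrite /v; ring.
  rewrite ler_pdivrMr ?mulr_gt0// mulrC ler_wpM2l//.
    by rewrite divr_ge0// ltW.
  by rewrite ler_pM// lerDl.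
rewrite le_min => /andP[wr _] /eqP; rewrite /T -subr_eq0.
rewrite addrAC subrr add0r oppr_eq0 => /eqP fPM.
exists w => //.
have Mu : M \in unitmx by rewrite unitmx_inv.
by rewrite -(mulmxK Mu (f w *m P)) fPM mul0mx.
Qed.

(** * Affine substitutions and strict differentiability *)

(** [lam] is the linear part of [l]; the two difference quotients are already equal before the limit
    is taken. *)
Lemma derive_comp_affine (R : realType) (U V W : normedModType R)
    (l lam : U -> V) (f : V -> W) (v x : U) :
  (forall h u z, l (h *: u + z) = h *: lam u + l z) ->
  'D_v (f \o l) x = 'D_(lam v) f (l x).
Proof.
move=> lE; rewrite /derive; set F := (fun _ => _); set G := (fun _ => _).
by have -> : F = G by apply/funext => h; rewrite /F /= lE.
Qed.

(** For an affine inner map, differentiating the composite gives again a composite with [l], so the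
    induction on [k] closes without a product rule. *)
Lemma Ck_on_comp_affine (R : realType) (U V W : normedModType R)
    (l lam : U -> V) (A : set V) k (f : V -> W) :
  (forall x, differentiable l x) ->
  (forall h u x, l (h *: u + x) = h *: lam u + l x) ->
  Ck_on k A f -> Ck_on k (l @^-1` A) (f \o l).
Proof.
move=> dl lE; elim: k f => [|k IHk] f /=.
  move=> fA x Alx; apply: continuous_comp; last exact: fA.
  exact: differentiable_continuous.
move=> [df CDf]; split=> [x Alx|v].
  exact: differentiable_comp (dl x) (df _ Alx).
rewrite (_ : (fun x => _) = (fun y => 'D_(lam v) f y) \o l); first exact: IHk.
by apply/funext => x; exact: derive_comp_affine.
Qed.

Lemma Ck_on_subset (R : realType) (V W : normedModType R) k (A B : set V)
    (f : V -> W) : B `<=` A -> Ck_on k A f -> Ck_on k B f.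
Proof.
move=> BA; elim: k f => [|k IHk] f /=; first by move=> fA x /BA/fA.
by move=> [df CDf]; split=> [x /BA/df//|v]; exact: IHk.
Qed.

Lemma row_jacobian (R : realType) n m (f : 'rV[R]_n -> 'rV[R]_m) x j :
  differentiable f x -> row j (jacobian f x) = 'D_(delta_mx 0 j) f x.
Proof. by move=> df; rewrite deriveEjacobian// -rowE. Qed.

(** The rows of the jacobian are the partial derivatives, which are finitely many and continuous. *)
Lemma Ck_on1_jacobian_near (R : realType) n m (A : set 'rV[R]_n)
    (f : 'rV[R]_n -> 'rV[R]_m) x e : open A -> Ck_on 1 A f -> A x -> 0 < e ->
  \forall y \near x, `|jacobian f y - jacobian f x| <= e.
Proof.
move=> oA [df Df] Ax e0.
have Anear : \forall y \near x, A y by exact: open_nbhs_nbhs.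
have Dnear : \forall y \near x, forall j : 'I_n,
    `|'D_(delta_mx 0 j) f x - 'D_(delta_mx 0 j) f y| <= e.
  apply: (@filter_forall _ _ (fun j y =>
    `|'D_(delta_mx 0 j) f x - 'D_(delta_mx 0 j) f y| <= e) _ (nbhs_filter x)) => j.
  by have /cvgrPdist_le := Df (delta_mx 0 j) x Ax; exact.
near=> y; apply: mx_norm_le => [|j i]; first exact: ltW.
have Ay : A y by near: y.
have Dy : `|'D_(delta_mx 0 j) f x - 'D_(delta_mx 0 j) f y| <= e.
  by move: j {i}; near: y.
rewrite distrC -!row_jacobian in Dy; try exact: df.
by rewrite (le_trans _ Dy)// (le_trans _ (entry_le_mx_norm _ 0 i))// !mxE.
Unshelve. all: by end_near. Qed.

(** The mean value theorem applies to each coordinate of [f] on the segment from [w'] to [w];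
    continuity of the jacobian replaces the intermediate point by [x]. *)
Lemma Ck_on1_strict_differentiable (R : realType) n m (A : set 'rV[R]_n)
    (f : 'rV[R]_n -> 'rV[R]_m) x e : open A -> Ck_on 1 A f -> A x -> 0 < e ->
  exists2 d, 0 < d & forall w w', `|w - x| <= d -> `|w' - x| <= d ->
    `|f w - f w' - (w - w') *m jacobian f x| <= e * `|w - w'|.
Proof.
move=> oA Cf Ax e0; have [df _] := Cf.
(* The divisor absorbs the factor [n] of [mx_norm_mulmx]; the successor keeps it positive when
   [n = 0]. *)
have e1 : 0 < e / n.+1%:R by rewrite divr_gt0.
have Anear : \forall y \near x, A y by exact: open_nbhs_nbhs.
have /nbhs_normP[d /= d0 dP] : \forall y \near x,
    A y /\ `|jacobian f y - jacobian f x| <= e / n.+1%:R.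
  exact: filterI Anear (Ck_on1_jacobian_near oA Cf Ax e1).
exists (d / 2); first by rewrite divr_gt0.
move=> w w' wd w'd; apply: mx_norm_le => [|k i].
  by rewrite mulr_ge0// ltW.
rewrite (ord1 k) {k}.
pose l (t : R^o) := t *: (w - w') + w'.
have lE h u z : l (h *: u + z) = h *: (u *: (w - w')) + l z.
  by rewrite /l scalerDl scalerA addrA.
have dl t : differentiable l t.
  by apply: differentiableD => //; exact: differentiableZl.
have lball t : 0 <= t -> t <= 1 -> `|x - l t| < d.
  move=> t0 t1; rewrite distrC.
  (* A convex combination of two vectors of norm at most [d / 2]. *)
  have -> : l t - x = t *: (w - x) + (1 - t) *: (w' - x).
    by apply/rowP => j; rewrite !mxE; ring.
  have t10 : 0 <= 1 - t by rewrite subr_ge0.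
  rewrite (le_lt_trans (ler_normD _ _))// !normrZ !ger0_norm//.
  rewrite (@le_lt_trans _ _ (t * (d / 2) + (1 - t) * (d / 2)))//.
    by rewrite lerD// ler_wpM2l.
  by rewrite -mulrDl addrC subrK mul1r ltr_pdivrMr// ltr_pMr// ltr1n.
have lP t : 0 <= t -> t <= 1 ->
    A (l t) /\ `|jacobian f (l t) - jacobian f x| <= e / n.+1%:R.
  by move=> t0 t1; apply: dP; exact: lball.
have hD t : 0 <= t -> t <= 1 ->
  is_derive (t : R^o) 1 (fun t => f (l t) 0 i : R^o)
    (((w - w') *m jacobian f (l t)) 0 i).
  move=> t0 t1; have [At _] := lP _ t0 t1.
  have dfl : differentiable (f \o l) t.
    exact: differentiable_comp (dl t) (df _ At).
  have derfl : derivable (f \o l) t 1 by exact: diff_derivable.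
  apply: DeriveDef; first by move/derivable_mxP: derfl; exact.
  have := derive_mx derfl; rewrite (derive_comp_affine f _ _ lE) scale1r.
  by rewrite (deriveEjacobian _ (df _ At)) => ->; rewrite mxE.
have [||c /andP[c0 c1]] := @MVT R (fun t => f (l t) 0 i)
    (fun t => ((w - w') *m jacobian f (l t)) 0 i) 0 1 ltr01.
- by move=> t /andP[t0 t1]; apply: hD; exact: ltW.
- apply: derivable_within_continuous => t /andP[t0 t1].
  by have [] := hD t t0 t1.
have {c0 c1}[_ jc] := lP _ (ltW c0) (ltW c1).
rewrite subr0 mulr1 {1 2}/l scale1r scale0r subrK add0r => fE.
have -> : (f w - f w' - (w - w') *m jacobian f x) 0 i =
    ((w - w') *m (jacobian f (l c) - jacobian f x)) 0 i.
  transitivity (f w 0 i - f w' 0 i - ((w - w') *m jacobian f x) 0 i).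
    by rewrite !mxE.
  rewrite fE mulmxBr [RHS]mxE; congr (_ + _).
  by rewrite [RHS]mxE.
rewrite (le_trans (entry_le_mx_norm _ _ _))// (le_trans (mx_norm_mulmx _ _))//.
rewrite mulrCA mulrC ler_wpM2r// (le_trans (ler_wpM2l _ jc))//.
by rewrite mulrCA ler_piMr ?(ltW e0)// ler_pdivrMr// mul1r ler_nat.
Qed.

(** * The slice inclusion and the projection along lines of sight *)

Lemma mulmxr_continuous (R : realType) n m (M : 'M[R]_(n, m)) :
  continuous (fun v : 'rV[R]_n => v *m M).
Proof.
apply: (linear_bounded_continuous (mulmxr M)).1; apply/linear_boundedP.
near=> r => x /=; rewrite (le_trans (mx_norm_mulmx _ _))//.
by rewrite mulrCA mulrC ler_wpM2r//; near: r; exact: nbhs_pinfty_ge.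
Unshelve. all: by end_near. Qed.

Lemma sliceE (R : realType) (w : 'rV[R]_2) :
  slice w = w *m (row_mx 1%:M 0 : 'M[R]_(2, 3)).
Proof.
by rewrite /slice (@mul_mx_row _ 1 2 2 1 w) mulmx1 mulmx0.
Qed.

Lemma differentiable_slice (R : realType) (w : 'rV[R]_2) :
  differentiable (@slice R) w.
Proof.
have -> : @slice R = mulmxr (row_mx 1%:M 0 : 'M[R]_(2, 3)).
  by apply/funext => u; exact: sliceE.
apply: linear_differentiable; exact: mulmxr_continuous.
Qed.

Lemma slice_linear (R : realType) h (u x : 'rV[R]_2) :
  slice (h *: u + x) = h *: slice u + slice x.
Proof. by rewrite !sliceE mulmxDl scalemxAl. Qed.

Lemma slice_inj (R : realType) : injective (@slice R).
Proof. by move=> u v /(@eq_row_mx _ 1 2 1)[]. Qed.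

Lemma coord2_slice (R : realType) (w : 'rV[R]_2) : slice w 0 2 = 0.
Proof.
have -> : 2 = rshift 2 0 :> 'I_3 by exact/val_inj.
by rewrite /slice (@row_mxEr _ 1 2 1) mxE.
Qed.

Lemma slice_lsubmx (R : realType) (x : 'rV[R]_3) :
  x 0 2 = 0 -> slice (lsubmx (x : 'rV_(2 + 1))) = x.
Proof.
move=> x0; rewrite /slice -[RHS](@hsubmxK _ 1 2 1); congr (@row_mx _ 1 2 1 _ _).
apply/rowP => i; rewrite !mxE (ord1 i) -x0; congr (x _ _); exact/val_inj.
Qed.

(* The kernel of [central_projection_mx q] is the line of sight through the
   image point [q], so that [image_formation y = q] becomes the equation
   [y *m central_projection_mx q = 0], which is linear in [y]. *)
Definition central_projection_mx (R : realType) (q : 'rV[R]_2) : 'M[R]_(3, 2) :=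
  col_mx 1%:M (- q).

Lemma central_projection_mxE (R : realType) (q : 'rV[R]_2) (y : 'rV[R]_3) i :
  (y *m central_projection_mx q) 0 i = y 0 (lshift 1 i) - y 0 2 * q 0 i.
Proof.
rewrite -[y in LHS](@hsubmxK _ 1 2 1) (@mul_row_col _ _ 2 1) mulmx1 mulmxN.
rewrite !mxE big_ord1 !mxE; congr (_ - y _ _ * _); exact/val_inj.
Qed.

Lemma central_projection_mx_image (R : realType) (q : 'rV[R]_2) (y : 'rV[R]_3) :
  y 0 2 != 0 -> y *m central_projection_mx q = 0 <-> image_formation y = q.
Proof.
move=> y2.
have iE i : image_formation y 0 i = y 0 (lshift 1 i) / y 0 2.
  rewrite mxE; case: i => -[|[|//]] i2 /=; congr (y _ _ / _); exact/val_inj.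
split=> [/rowP yq | <-]; apply/rowP => i.
  have := yq i; rewrite central_projection_mxE iE mxE => /subr0_eq ->.
  by rewrite mulrAC mulfV// mul1r.
by rewrite central_projection_mxE iE mxE mulrCA mulfV// mulr1 subrr.
Qed.

Lemma central_projection_mx_ker (R : realType) (q : 'rV[R]_2) (y : 'rV[R]_3) :
  y *m central_projection_mx q = 0 -> y = y 0 2 *: (row_mx q 1 : 'rV_(2 + 1)).
Proof.
move=> /rowP yq; apply/rowP => i; rewrite mxE.
case: (@splitP 2 1 i) => j ij.
  have -> : i = lshift 1 j by exact/val_inj.
  rewrite (@row_mxEl _ 1 2 1); have := yq j.
  by rewrite central_projection_mxE mxE => /subr0_eq.
have -> : i = rshift 2 j by exact/val_inj.
rewrite (@row_mxEr _ 1 2 1) (ord1 j) mxE eqxx mulr1; congr (y _ _); exact/val_inj.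
Qed.

(** Only the last row depends on [q], so two such matrices differ by that row alone. *)
Lemma central_projection_mx_continuous (R : realType) :
  continuous (@central_projection_mx R).
Proof.
move=> q; apply/(@cvgrPdist_le _ _ _ (nbhs q)) => e e0; near=> q'.
apply: mx_norm_le => [|i j]; first exact: ltW.
have qq' : `|q - q'| <= e.
  by near: q'; apply: cvgr_dist_le => //; exact: cvg_id.
rewrite /central_projection_mx (@opp_col_mx _ 2 1) (@add_col_mx _ 2 1) subrr.
case: (@splitP 2 1 i) => k ik.
  have -> : i = lshift 1 k by exact/val_inj.
  by rewrite (@col_mxEu _ 2 1) mxE normr0 ltW.
have -> : i = rshift 2 k by exact/val_inj.
rewrite (@col_mxEd _ 2 1) opprK addrC (le_trans _ qq')//.
by rewrite (ord1 k) -normrN opprB (le_trans (entry_le_mx_norm _ _ _)).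
Unshelve. all: by end_near. Qed.

(** * Local surjectivity of image formation on the surface *)

(** With [f] the local parametrization, [q] enters the equation only through the matrix
    [central_projection_mx q], so [strict_differentiable_solve] applies once [J_unit] is known. *)
Lemma surjective_near_unoccluding (R : realType) (S V W : set 'rV[R]_3)
    phi psi (a : 'rV[R]_3) (w0 : 'rV[R]_2) (r : R) :
  (forall b, S b -> b 0 2 != 0) -> slice_chart S V W phi psi ->
  V a -> S a -> ~ occluding_point S a -> slice w0 = phi a -> 0 < r ->
  \forall q \near image_formation a, exists w,
    [/\ `|w - w0| < r, W (slice w) & image_formation (psi (slice w)) = q].
Proof.
move=> S0 [[oV oW] VW WV [phiS psiS] SV] Va Sa unocc w0E r0.
pose A := @slice R @^-1` W; pose f := psi \o @slice R.
have oA : open A.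
  apply: open_comp oW => x _; exact/differentiable_continuous/differentiable_slice.
have Cf k : Ck_on k A f.
  exact: Ck_on_comp_affine (@differentiable_slice R) (@slice_linear R) (psiS k).
have df x : A x -> differentiable f x by have [df _] := Cf 1; exact: df.
have Sf w : A w -> S (f w).
  move=> Aw; have [Vw phiw] := WV _ Aw.
  by apply/(SV _ Vw); rewrite phiw coord2_slice.
have [Wa psia] := VW _ Va.
have Aw0 : A w0 by rewrite /A /= w0E.
have Anear : \forall w \near w0, A w by exact: open_nbhs_nbhs.
have fw0 : f w0 = a by rewrite /f /= w0E.
set p := image_formation a.
have pa : a *m central_projection_mx p = 0.
  exact/central_projection_mx_image/erefl/S0.
(* Near [w0] the composite [phi \o f] is [slice], so a vector killed by the derivative of [f] is
   killed by the injective [slice]. *)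
have J_inj (v : 'rV_2) : v *m jacobian f w0 = 0 -> v = 0.
  rewrite -deriveEjacobian; last exact: df.
  rewrite deriveE; last exact: df.
  move=> dfv; apply/slice_inj.
  have -> : slice v = 'D_v (@slice R) w0.
    by rewrite (derive_comp_affine id _ _ (@slice_linear R)) derive_id.
  rewrite -(@near_eq_derive _ _ _ (phi \o f)); last first.
    by apply: filterS Anear => w Aw; exact: (WV _ Aw).2.
  have dphi : differentiable phi (f w0).
    by have [dphi _] := phiS 1; apply: dphi; rewrite fw0.
  rewrite deriveE; last exact: differentiable_comp (df _ Aw0) dphi.
  rewrite (diff_comp (df _ Aw0) dphi) /= dfv linear0.
  by rewrite sliceE mul0mx.
have J_unit : jacobian f w0 *m central_projection_mx p \in unitmx.
  rewrite -row_free_unit; apply/inj_row_free => v; rewrite mulmxA.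
  (* The tangent vector [y] lies along the line of sight. If its third coordinate vanishes, so does
     [y]; otherwise [a] is an occluding point. *)
  move=> /central_projection_mx_ker; set y := v *m _ => yE.
  have [y2|y2] := eqVneq (y 0 2) 0.
    by apply: J_inj; rewrite -/y yE y2 scale0r.
  exfalso; apply: unocc; split=> //; exists (- a); last by rewrite subrr.
  (* Both [a] and [y] are multiples of [row_mx p 1], and this factor turns [y] into [- a], the
     velocity of [f \o l] at [0]. *)
  pose u := - (a 0 2 / y 0 2) *: v; pose l (t : R^o) := t *: u + w0.
  have lE h x z : l (h *: x + z) = h *: (x *: u) + l z.
    by rewrite /l scalerDl (scalerA h x u) addrA.
  have dl t : differentiable l t.
    by apply: differentiableD => //; exact: differentiableZl.
  have l0 : l 0 = w0 by rewrite /l scale0r add0r.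
  have /nbhs_normP[e /= e0 eA] : \forall t \near (0 : R^o), A (l t).
    apply: (differentiable_continuous (dl 0)).
    by rewrite l0.
  have eA' t : `|t| < e -> A (l t).
    by move=> te; apply: eA; rewrite /= sub0r normrN.
  exists e, (f \o l); split => //=.
  - move=> k; apply: Ck_on_subset (Ck_on_comp_affine dl lE (Cf k)) => t.
    exact: eA'.
  - by move=> t /eA'/Sf.
  - by rewrite l0.
  - rewrite derive1E (derive_comp_affine f _ _ lE) scale1r l0.
    rewrite deriveEjacobian; last exact: df.
    rewrite -scalemxAl -/y [X in _ *: X]yE scalerA mulNr divfK// scaleNr.
    by rewrite -(central_projection_mx_ker pa).
have /nbhs_normP[d /= d0 dA] := Anear.
(* Halving turns the non-strict bound on the solution into the strict ones required by [r] and
   [d]. *)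
have s0 : 0 < Num.min (r / 2) (d / 2) by rewrite lt_min !divr_gt0.
have fw0p : f w0 *m central_projection_mx p = 0 by rewrite fw0.
have solve := strict_differentiable_solve
  (fun e e0 => Ck_on1_strict_differentiable oA (Cf 1) Aw0 e0) J_unit fw0p s0.
have {solve} : \forall q \near p,
    exists2 w, `|w - w0| <= Num.min (r / 2) (d / 2) &
    f w *m central_projection_mx q = 0.
  exact: (@central_projection_mx_continuous R p _ solve).
apply: filterS => q [w]; rewrite le_min => /andP[wr wd] fwq; exists w.
have Aw : A w.
  apply: dA; rewrite /= distrC (le_lt_trans wd)//.
  by rewrite ltr_pdivrMr// ltr_pMr// ltr1n.
split=> //.
  by rewrite (le_lt_trans wr)// ltr_pdivrMr// ltr_pMr// ltr1n.
by apply/central_projection_mx_image; [exact/S0/Sf|].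
Qed.

(** * Isophotes and the conclusion *)

(** If [I p < c], the inequality persists near [p] in [U] and makes [p] interior; if [c < I p], a
    neighbourhood of [p] in [U] misses the sublevel set, so [p] is not in the closure. *)
Lemma isophote_level (R : realType) (U : set 'rV[R]_2) (I : 'rV[R]_2 -> R) c p :
  U p -> I @ within U (nbhs p) --> I p -> isophote U I c p -> I p = c.
Proof.
move=> Up Icont [pcl pint].
have nbhsE : nbhs (p : subspace U) = within U (nbhs p).
  by rewrite (nbhs_subspace_in Up).
have [Ipc|cIp|//] := ltgtP (I p) c; exfalso.
- have Ilt : \forall q \near p, U q -> I q < c by exact: (cvgr_lt _ Icont _ Ipc).
  apply: pint; rewrite /interior /= nbhsE.
  suff : \forall q \near p, U q -> U q /\ I q < c by [].
  by near=> q => Uq; split=> //; move: Uq; near: q.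
- have Igt : \forall q \near p, U q -> c < I q by exact: (cvgr_gt _ Icont _ cIp).
  have /pcl[q [[Uq Iqc]]] : nbhs (p : subspace U) [set q | U q -> c < I q].
    rewrite nbhsE; suff : \forall q \near p, U q -> U q -> c < I q by [].
    by near=> q => Uq; near: q.
  by move=> /(_ Uq) /(lt_trans Iqc); rewrite ltxx.
Unshelve. all: by end_near. Qed.

Theorem theorem2 (R : realType) (S : set 'rV[R]_3) (J : 'rV[R]_3 -> R)
    (I : 'rV[R]_2 -> R) (p : 'rV[R]_2) (c c' : R)
    (hS : forall a, S a -> a 0 2 != 0)
    (hI : is_image S J I)
    (hp : image_domain S p)
    (hcc' : c <> c')
    (hpc : isophote (image_domain S) I c p)
    (hpc' : isophote (image_domain S) I c' p) :
  ~ smooth_intensity S J \/ ~ smooth_surface S \/ occluded S.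
Proof.
have [sJ|] := pselect (smooth_intensity S J); last by left.
right; right => -[inj unocc]; apply: hcc'.
suff Icont : I @ within (image_domain S) (nbhs p) --> I p.
  by rewrite -(isophote_level hp Icont hpc) -(isophote_level hp Icont hpc').
have [a [Sa ap Ip]] := hI _ hp.
have [V [W [phi [psi [Va chart sJa]]]]] := sJ _ Sa.
have [_ VW WV _ SV] := chart.
have [Wa psia] := VW _ Va.
pose w0 : 'rV[R]_2 := lsubmx (phi a : 'rV_(2 + 1)).
have w0E : slice w0 = phi a by apply: slice_lsubmx; exact/(SV _ Va).
apply/cvgrPdist_lt => e e0.
have Jw0 : {for w0, continuous (fun w => J (psi (slice w)) : R^o)}.
  (* Order [0] of smoothness is continuity. *)
  by apply: (sJa 0); rewrite /= w0E.
have /nbhs_normP[r /= r0 rJ] :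
    \forall w \near w0, `|J (psi (slice w0)) - J (psi (slice w))| < e.
  by have /cvgrPdist_lt := Jw0; apply.
have := surjective_near_unoccluding hS chart Va Sa _ w0E r0.
rewrite ap => surj.
have /surj : ~ occluding_point S a by move=> occ; apply: unocc; exists a.
apply: filterS => q [w [wr Ww wq]] Uq.
(* The image could a priori take its value at [q] from a point far from [a]; injectivity identifies
   [b] with the nearby point [psi (slice w)]. *)
have [b [Sb bq ->]] := hI _ Uq.
have [Vw phiw] := WV _ Ww.
have <- : psi (slice w) = b.
  apply: inj; rewrite ?wq ?bq//.
  by apply/(SV _ Vw); rewrite phiw coord2_slice.
by rewrite Ip -{1}psia -w0E; apply: rJ; rewrite /= distrC.
Qed.
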